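(* Let $T$ be an averaging operator on the Virasoro conformal algebra $\mathrm{Vir} = \mathbb C[\partial ]v$. Then $T(v)=\alpha v$ for some $\alpha \in \mathbb C$.
   Context: A conformal algebra is a complex linear space $C$ with a linear operator $\partial:C\to C$ and bilinear products $[\cdot\,{}_{(n)}\,\cdot]$, $n\in\mathbb Z_+=\{0,1,2,\dots\}$, such that for all $a,b\in C$: (C1) there is $N=N(a,b)$ with $[a\,{}_{(n)}\,b]=0$ for $n\ge N$; (C2) $[\partial a\,{}_{(n)}\,b]=-n[a\,{}_{(n-1)}\,b]$; (C3) $[a\,{}_{(n)}\,\partial b]=\partial([a\,{}_{(n)}\,b])+n[a\,{}_{(n-1)}\,b]$. The Virasoro conformal algebra $\mathrm{Vir}$ is the free $\mathbb C[\partial]$-module of rank one with generator $v$, with products determined by (C2), (C3) and $[v\,{}_{(0)}\,v]=\partial v$, $[v\,{}_{(1)}\,v]=2v$, $[v\,{}_{(n)}\,v]=0$ for $n\ge 2$. An averaging operator on a conformal algebra $C$ is a $\mathbb C[\partial]$-linear map $T:C\to C$ such that $T([T(a)\,{}_{(n)}\,b])=[T(a)\,{}_{(n)}\,T(b)]$ for all $a,b\in C$, $n\in\mathbb Z_+$. *)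

(* Defs.v *)
From HB Require Import structures.
From mathcomp Require Import all_boot all_order all_algebra.
From mathcomp Require Import complex reals.

Set Implicit Arguments.
Unset Strict Implicit.
Unset Printing Implicit Defensive.

Import GRing.Theory.
Local Open Scope ring_scope.

(* In [cprod_derl] and [cprod_derr] the predecessor is truncated, so
   that [n.-1 = 0] for [n = 0]; the corresponding term is then multiplied by 0,
   which matches the usual convention that it vanishes. *)
HB.mixin Record isConformal (K : fieldType) C of GRing.Lmodule K C := {
  cder : C -> C;
  cprod : C -> nat -> C -> C;
  cder_linear : linear cder;
  cprod_linearl : forall n b, linear (fun a => cprod a n b);
  cprod_linearr : forall n a, linear (cprod a n);
  cprod_local : forall a b,
    exists N, forall n, (N <= n)%N -> cprod a n b = 0;
  cprod_derl : forall n a b, cprod (cder a) n b = - (cprod a n.-1 b *+ n);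
  cprod_derr : forall n a b,
    cprod a n (cder b) = cder (cprod a n b) + cprod a n.-1 b *+ n
}.

#[short(type="conformalType")]
HB.structure Definition Conformal (K : fieldType) :=
  { C of isConformal K C & GRing.Lmodule K C }.

Notation "[ a '_(' n ) b ]" := (cprod a n b)
  (at level 0, a at level 9, n at level 99, b at level 9,
   format "[ a  '_(' n )  b ]") : ring_scope.

Section ConformalDefs.
Variables (K : fieldType) (C : conformalType K).

(* The action of [p] in K[\partial] on [a]. *)
Definition cact (p : {poly K}) (a : C) : C :=
  \sum_(i < size p) p`_i *: iter i cder a.

Definition free_rank1_gen (v : C) : Prop :=
  forall a : C, exists! p : {poly K}, a = cact p v.

Definition is_virasoro (v : C) : Prop :=
  [/\ free_rank1_gen v,
      [v _(0) v] = cder v,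
      [v _(1) v] = v *+ 2 &
      forall n, (2 <= n)%N -> [v _(n) v] = 0].

Definition averaging (T : C -> C) : Prop :=
  [/\ linear T,
      forall a, T (cder a) = cder (T a) &
      forall a b n, T [(T a) _(n) b] = [(T a) _(n) (T b)]].

End ConformalDefs.

(* A model, which shows that [is_virasoro] is satisfiable: K[\partial] with
   [v = 1], where [f _(n) g] is n! times the coefficient of lambda^n in the
   lambda-bracket f(- lambda) g(\partial + lambda) (\partial + 2 lambda).  The
   outer variable of {poly {poly K}} is lambda, the inner one is \partial. *)
Section VirasoroModel.
Variable K : fieldType.

Definition vir_poly : Type := {poly K}.
HB.instance Definition _ := GRing.Lmodule.copy vir_poly {poly K}.

Definition vir_bracket (f g : {poly K}) : {poly {poly K}} :=
  (f^:P \Po (- 'X)) * (g^:P \Po ('X + 'X%:P)) * ('X%:P + 'X *+ 2).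

Definition vir_der (f : vir_poly) : vir_poly := 'X * (f : {poly K}).
Definition vir_prod (f : vir_poly) (n : nat) (g : vir_poly) : vir_poly :=
  (vir_bracket f g)`_n *+ n`!.

Fact vir_der_linear : linear vir_der.
Proof. by move=> k f g; rewrite /vir_der mulrDr -scalerAr. Qed.

Fact vir_bracket_linearl (k : K) (f h g : {poly K}) :
  vir_bracket (k *: f + h) g = k%:P *: vir_bracket f g + vir_bracket h g.
Proof.
rewrite /vir_bracket -!mul_polyC rmorphD rmorphM /=.
by rewrite map_polyC comp_polyD comp_polyM comp_polyC !mulrDl !mulrA.
Qed.

Fact vir_bracket_linearr (k : K) (f g h : {poly K}) :
  vir_bracket f (k *: g + h) = k%:P *: vir_bracket f g + vir_bracket f h.
Proof.
rewrite /vir_bracket -!mul_polyC rmorphD rmorphM /=.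
rewrite map_polyC comp_polyD comp_polyM comp_polyC.
by move: ('X%:P + 'X *+ 2) => c; rewrite mulrDr mulrDl mulrCA -!mulrA.
Qed.

Fact vir_prod_linearl n g : linear (fun f => vir_prod f n g).
Proof.
move=> k f h; rewrite /vir_prod vir_bracket_linearl coefD coefZ mul_polyC.
by rewrite mulrnDl -scalerMnr.
Qed.

Fact vir_prod_linearr n f : linear (vir_prod f n).
Proof.
move=> k g h; rewrite /vir_prod vir_bracket_linearr coefD coefZ mul_polyC.
by rewrite mulrnDl -scalerMnr.
Qed.

Fact vir_prod_local f g :
  exists N, forall n, (N <= n)%N -> vir_prod f n g = 0.
Proof.
exists (size (vir_bracket f g)) => n le_n.
by rewrite /vir_prod nth_default // mul0rn.
Qed.

Fact vir_prod_derl n f g :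
  vir_prod (vir_der f) n g = - (vir_prod f n.-1 g *+ n).
Proof.
rewrite /vir_prod /vir_bracket /vir_der rmorphM /= map_polyX comp_polyM.
rewrite comp_polyX !mulNr coefN mulNrn -!mulrA coefXM.
by case: n => [|n] /=; rewrite ?mulr0n ?mul0rn // factS mulnC mulrnA.
Qed.

Fact vir_prod_derr n f g :
  vir_prod f n (vir_der g) = vir_der (vir_prod f n g) + vir_prod f n.-1 g *+ n.
Proof.
rewrite /vir_prod /vir_der /vir_bracket rmorphM /= map_polyX comp_polyM.
rewrite comp_polyX mulrCA mulrDl mulrDl -!(mulrA 'X) -!(mulrA 'X%:P) coefD.
rewrite coefXM coefCM mulrnDl addrC mulrnAr; congr (_ + _).
by case: n => [|n] /=; rewrite ?mulr0n ?mul0rn // factS mulnC mulrnA.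
Qed.

HB.instance Definition _ := isConformal.Build K vir_poly vir_der_linear
  vir_prod_linearl vir_prod_linearr vir_prod_local vir_prod_derl vir_prod_derr.

Definition vir_gen : vir_poly := (1 : {poly K}).

Lemma vir_gen_is_virasoro : is_virasoro vir_gen.
Proof.
have actE p : cact p vir_gen = p.
  rewrite -[RHS]coefK poly_def /cact; apply: eq_bigr => i _; congr (_ *: _).
  elim: (i : nat) => [|j IHj] //=; rewrite IHj exprS //.
have prodE n : cprod vir_gen n vir_gen
    = (('X%:P + 'X *+ 2 : {poly {poly K}})`_n *+ n`! : {poly K}).
  by rewrite /cprod /= /vir_prod /vir_bracket rmorph1 !comp_polyC !mul1r.
split.
- by move=> a; exists a; split=> [|p ->]; rewrite actE.
- by rewrite prodE coefD coefC coefMn coefX mul0rn addr0 /cder /= /vir_der mulr1.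
- by rewrite prodE coefD coefC coefMn coefX add0r.
case=> [|[|n]] // _.
by rewrite prodE coefD coefC coefMn coefX mul0rn addr0 mul0rn.
Qed.

End VirasoroModel.

(* Main.v *)
Require Import Defs.
From mathcomp Require Import all_boot all_order all_algebra.
From mathcomp Require Import complex reals.

Import GRing.Theory.
Local Open Scope ring_scope.
Local Open Scope complex_scope.

(** Write T(v) = f(∂)v and let m be the degree of f.  The highest nonvanishing
    product of f(∂)v with v has order m + 1, whereas that of f(∂)v with itself
    has order 2m + 1.  If m > 0, the averaging identity at order 2m + 1
    therefore equates T(0) = 0 with a nonzero multiple of v. *)

Section TopTerm.
Set Implicit Arguments.
Unset Strict Implicit.
Variables (K : fieldType) (V : lmodType K).

(** The scalar stays existential: it accumulates signs, factorials and leading coefficients, and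
    only its being nonzero matters later. *)
Definition top_term (s : nat -> V) (N : nat) (c : V) : Prop :=
  exists2 k : K, k != 0 & (forall n, (N < n)%N -> s n = 0) /\ s N = k *: c.

(** The tops sit at distinct indices [N + i], so at [N] plus the degree of [p] only the leading
    summand survives and nothing can cancel it. *)
Lemma top_term_sum (s : nat -> nat -> V) (N : nat) (c : V) (p : {poly K}) :
    p != 0 -> (forall i, top_term (s i) (N + i) c) ->
  top_term (fun n => \sum_(i < size p) p`_i *: s i n) (N + (size p).-1) c.
Proof.
move=> p_neq0 tops; have := p_neq0; rewrite -size_poly_gt0.
have := p_neq0; rewrite -lead_coef_eq0 lead_coefE.
case: (size p) => // m /= pm_neq0 _; have [k k_neq0 [_ topE]] := tops m.
exists (p`_m * k); first by rewrite mulf_neq0.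
split=> [n lt_n|].
  apply: big1 => i _; have [_ _ [vanish _]] := tops i.
  by rewrite vanish ?scaler0 // (leq_ltn_trans _ lt_n) // leq_add2l -ltnS.
rewrite big_ord_recr /= topE scalerA big1 ?add0r // => i _.
have [_ _ [vanish _]] := tops i; by rewrite vanish ?scaler0 // ltn_add2l.
Qed.

End TopTerm.

Section ConformalTop.
Set Implicit Arguments.
Unset Strict Implicit.
Variables (K : fieldType) (C : conformalType K).
Hypothesis pcharK0 : [pchar K] =i pred0.

Lemma cder0 : cder (0 : C) = 0.
(* With scalar -1 and both vectors 0, linearity reads [cder (- 0 + 0) = - cder 0 + cder 0]. *)
Proof. by have := @cder_linear K C (-1) 0 0; rewrite !scaleN1r !addNr. Qed.

Lemma cprod0l n (b : C) : [0 _(n) b] = 0.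
Proof. by have := @cprod_linearl K C n b (-1) 0 0; rewrite !scaleN1r !addNr. Qed.

Lemma cprod0r n (a : C) : [a _(n) 0] = 0.
Proof. by have := @cprod_linearr K C n a (-1) 0 0; rewrite !scaleN1r !addNr. Qed.

Lemma cprod_cactl (p : {poly K}) (a b : C) n :
  [(cact p a) _(n) b] = \sum_(i < size p) p`_i *: [(iter i cder a) _(n) b].
Proof.
rewrite /cact; apply: (big_rec2 (fun x y => [x _(n) b] = y)).
  exact: cprod0l.
by move=> i x y _ <-; rewrite cprod_linearl.
Qed.

Lemma cprod_cactr (p : {poly K}) (a b : C) n :
  [a _(n) (cact p b)] = \sum_(i < size p) p`_i *: [a _(n) (iter i cder b)].
Proof.
rewrite /cact; apply: (big_rec2 (fun x y => [a _(n) x] = y)).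
  exact: cprod0r.
by move=> i x y _ <-; rewrite cprod_linearr.
Qed.

Lemma natS_neq0 n : n.+1%:R != 0 :> K.
Proof. by rewrite (pcharf0P K).1. Qed.

(** By (C2) the sequence shifts by one index and its top is multiplied by [- N.+1%:R], which is
    nonzero in characteristic 0. *)
Lemma top_cderl (a b c : C) N :
  top_term (cprod a ^~ b) N c -> top_term (cprod (cder a) ^~ b) N.+1 c.
Proof.
case=> k k_neq0 [vanish topE]; exists (- (N.+1%:R * k)).
  by rewrite oppr_eq0 mulf_neq0 ?natS_neq0.
split=> [[//|n] lt_n|]; rewrite cprod_derl /=.
  by rewrite vanish // mul0rn oppr0.
by rewrite topE scaleNr -scalerA scaler_nat.
Qed.

(** Above index [N] the derivative term in (C3) is zero, so (C3) acts there like (C2) up to sign. *)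
Lemma top_cderr (a b c : C) N :
  top_term (cprod a ^~ b) N c -> top_term (cprod a ^~ (cder b)) N.+1 c.
Proof.
case=> k k_neq0 [vanish topE]; exists (N.+1%:R * k).
  by rewrite mulf_neq0 ?natS_neq0.
split=> [[//|n] lt_n|]; rewrite cprod_derr /= vanish ?cder0 ?add0r //.
- by rewrite vanish // mul0rn.
- exact: ltnW.
by rewrite topE -scalerA scaler_nat.
Qed.

Lemma top_cactl (p : {poly K}) (a b c : C) N :
    p != 0 -> top_term (cprod a ^~ b) N c ->
  top_term (cprod (cact p a) ^~ b) (N + (size p).-1) c.
Proof.
move=> p_neq0 top_ab.
have [i|k k_neq0 [vanish topE]] :=
    @top_term_sum _ _ (fun i n => [(iter i cder a) _(n) b]) N c p p_neq0.
  by elim: i => [|i IHi]; rewrite ?addn0 // addnS; apply: top_cderl.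
exists k => //; split=> [n lt_n|]; rewrite cprod_cactl; last exact: topE.
exact: vanish.
Qed.

Lemma top_cactr (p : {poly K}) (a b c : C) N :
    p != 0 -> top_term (cprod a ^~ b) N c ->
  top_term (cprod a ^~ (cact p b)) (N + (size p).-1) c.
Proof.
move=> p_neq0 top_ab.
have [i|k k_neq0 [vanish topE]] :=
    @top_term_sum _ _ (fun i n => [a _(n) (iter i cder b)]) N c p p_neq0.
  by elim: i => [|i IHi]; rewrite ?addn0 // addnS; apply: top_cderr.
exists k => //; split=> [n lt_n|]; rewrite cprod_cactr; last exact: topE.
exact: vanish.
Qed.

(** If [v] were 0, the polynomials 0 and 1 would both represent 0, against uniqueness. *)
Lemma free_rank1_gen_neq0 (v : C) : free_rank1_gen v -> v != 0.
Proof.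
move=> free_v; apply/eqP => v0; have [p [_ uniq_p]] := free_v 0.
have p0 : p = 0 by apply: uniq_p; rewrite /cact size_poly0 big_ord0.
have p1 : p = 1.
  by apply: uniq_p; rewrite /cact size_poly1 big_ord1 /= v0 scaler0.
by have := oner_neq0 {poly K}; rewrite -p1 p0 eqxx.
Qed.

Lemma averaging_virasoro (v : C) (T : C -> C) :
  is_virasoro v -> averaging T -> exists alpha : K, T v = alpha *: v.
Proof.
move=> [free_v _ vv1 vv2] [T_lin _ T_avg].
have [f [Tv _]] := free_v (T v).
have [le_f1|gt_f1] := leqP (size f) 1.
  exists f`_0; rewrite Tv /cact.
  (* For [f] of size 0 the sum is empty, and the default value gives that the coefficient at 0
     vanishes as well. *)
  case: (size f) le_f1 (nth_default 0 (leqnn (size f))) => [|[|//]] _.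
    by rewrite big_ord0 => ->; rewrite scale0r.
  by rewrite big_ord1.
have f_neq0 : f != 0 by rewrite -size_poly_gt0 ltnW.
have top_vv : top_term (cprod v ^~ v) 1 v.
  by exists 2%:R; rewrite ?natS_neq0 //; split=> //; rewrite vv1 scaler_nat.
have top_wv := top_cactl f_neq0 top_vv.
have [k k_neq0 [_ wwE]] := top_cactr f_neq0 top_wv.
have [_ _ [wv0 _]] := top_wv.
have T0 : T 0 = 0 by have := T_lin (-1) 0 0; rewrite !scaleN1r !addNr.
(* With m the degree of [f], this is order 2m + 1; since m > 0 it exceeds m + 1, so the product
   inside [T] is zero. *)
have := T_avg v v (1 + (size f).-1 + (size f).-1)%N.
rewrite Tv wwE wv0; last by rewrite -[ltnLHS]addn0 ltn_add2l -subn1 subn_gt0.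
move/esym/eqP; rewrite T0 scaler_eq0 (negPf k_neq0).
by rewrite (negPf (free_rank1_gen_neq0 free_v)).
Qed.

End ConformalTop.

Theorem proposition2 (R : realType) (Vir : conformalType R[i]) (v : Vir)
    (T : Vir -> Vir) :
  is_virasoro v -> averaging T -> exists alpha : R[i], T v = alpha *: v.
(* [R[i]] is a numeric domain, hence of characteristic 0. *)
Proof. exact/averaging_virasoro/Num.Theory.pchar_num. Qed.
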